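(* Let $k\ge 2$, let $\tau$ be any permutation of length $k-1$, let $\alpha$ be any permutation of length $k+1$, and let $A_\tau=\{\tau\}\cup\{\pi\in S_k : \tau\not\le\pi\}$. Then the antichain $U_{A_\tau,\alpha}$ has a proper growth rate $\mathrm{gr}(U_{A_\tau,\alpha})$. Moreover, $\mathrm{gr}(U_{A_\tau,\alpha})\to\infty$ as $k\to\infty$ (for any choice, for each $k$, of $\tau$ of length $k-1$ and $\alpha$ of length $k+1$).
   Context: A permutation of length $n$ is a bijection $\pi$ of $\{1,\dots,n\}$, written as the sequence $\pi(1)\cdots\pi(n)$; $S_k$ is the set of permutations of length $k$. A permutation $\pi$ contains a permutation $\sigma$ of length $k$, written $\sigma\le\pi$, if $\pi$ has a (not necessarily contiguous) subsequence of length $k$ in the same relative order as $\sigma$. An antichain is a set of permutations that are pairwise incomparable under $\le$. Growth rates: for a set $X$ of permutations, $X_n$ is the set of its members of length $n$. The set $X$ has a proper growth rate if $\liminf_{n\to\infty}\sqrt[n]{|X_n|}=\limsup_{n\to\infty}\sqrt[n]{|X_n|}$, and the common value is then denoted $\mathrm{gr}(X)$. Inflation: given a permutation $\sigma$ of length $m$ and nonempty permutations $\alpha_1,\dots,\alpha_m$, the inflation $\sigma[\alpha_1,\dots,\alpha_m]$ is the permutation of length $|\alpha_1|+\cdots+|\alpha_m|$ obtained by replacing each entry $\sigma(i)$ by an interval (a block of entries occupying contiguous positions and having contiguous values) that is order isomorphic to $\alpha_i$, in such a way that the intervals are in the same relative order as the entries of $\sigma$. For example $2413[1,132,321,12]=4\,798\,321\,56$.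 We say that the entry $\sigma(i)$ is inflated by $\alpha_i$. Increasing oscillations: the increasing oscillating sequence is $4,1,6,3,8,5,\dots,2j+2,2j-1,\dots$ (the $(2j-1)$-st term is $2j+2$ and the $2j$-th term is $2j-1$). For $m\ge 4$, $\sigma_m$ is the permutation of length $m$ in the same relative order as the first $m$ entries of this sequence if $m$ is even, or as the subsequence formed by the $m$ least entries (by value) of this sequence if $m$ is odd. The set $U_{A,\alpha}$: for an antichain $A$ and a permutation $\alpha$ not contained in any member of $A$, $U_{A,\alpha}$ is the set of all permutations obtained, for some $m\ge 4$, as follows: if $m$ is even, inflate the least and greatest entries of $\sigma_m$ by $\alpha$ and inflate every other entry of $\sigma_m$ by an arbitrary element of $A$; if $m$ is odd, inflate the least and rightmost entries of $\sigma_m$ by $\alpha$ and inflate every other entry of $\sigma_m$ by an arbitrary element of $A$ (elements of $A$ are chosen independently for the different entries). *)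

(* Defs.v *)
From HB Require Import structures.
From mathcomp Require Import all_boot all_order all_algebra all_fingroup.
From mathcomp Require Import all_classical all_reals all_analysis.

Set Implicit Arguments.
Unset Strict Implicit.
Unset Printing Implicit Defensive.

Import Order.TTheory GRing.Theory Num.Theory.

Local Open Scope classical_set_scope.

(* Permutations of length n are the elements of 'S_n.  A set of permutations
   of various lengths is represented by the set of their one-line notations
   p(1) ... p(n), which are words with entries 1, ..., n. *)
Definition word (n : nat) (p : 'S_n) : seq nat :=
  [seq (nat_of_ord (p i)).+1 | i <- enum 'I_n].

Definition same_order (u v : seq nat) : Prop :=
  size u = size v /\
  forall i j : nat, i < size u -> j < size u ->
    (nth 0 u i < nth 0 u j) = (nth 0 v i < nth 0 v j).

Definition contained (s p : seq nat) : Prop :=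
  exists2 u : seq nat, subseq u p & same_order s u.

Definition standardize (w : seq nat) : seq nat :=
  [seq (count (fun u => u < v) w).+1 | v <- w].

(* The inflation s[a_0, ..., a_(m-1)], m = size s: the block replacing the
   entry s_i is a_i, shifted up by the total length of the blocks that replace
   the entries of s smaller than s_i. *)
Definition inflation (s : seq nat) (a : seq (seq nat)) : seq nat :=
  flatten
    [seq [seq v + \sum_(0 <= j < size s | nth 0 s j < nth 0 s i)
                    size (nth [::] a j)
         | v <- nth [::] a i]
    | i <- iota 0 (size s)].

(* The n-th term, n >= 1, of 4, 1, 6, 3, 8, 5, ... *)
Definition oscillation (n : nat) : nat := if odd n then n + 3 else n - 1.

(* The values of the sequence are 1, 3, 4, 5, ..., each taken once, so the m
   least ones are those that are at most m + 1; these all occur among the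
   first m + 2 terms. *)
Definition osc_entries (m : nat) : seq nat :=
  if odd m then [seq v <- [seq oscillation n | n <- iota 1 (m + 2)] | v <= m + 1]
  else [seq oscillation n | n <- iota 1 m].

Definition sigma (m : nat) : seq nat := standardize (osc_entries m).

(* The entry of sigma m at the (0-based) position i is inflated by alpha: it is
   the least entry, or the greatest (m even) or rightmost (m odd) entry. *)
Definition end_entry (m i : nat) : bool :=
  (nth 0 (sigma m) i == 1) ||
  (if odd m then i == m.-1 else nth 0 (sigma m) i == m).

Definition U (A : set (seq nat)) (alpha : seq nat) : set (seq nat) :=
  [set w | exists (m : nat) (a : seq (seq nat)),
     [/\ 4 <= m,
         size a = m,
         forall i : nat, i < m ->
           if end_entry m i then nth [::] a i = alpha else A (nth [::] a i)
       & w = inflation (sigma m) a]].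

Definition A_ (k : nat) (tau : 'S_k.-1) : set (seq nat) :=
  [set w | w = word tau \/
     exists2 p : 'S_k, ~ contained (word tau) (word p) & w = word p].

Definition count_length (X : set (seq nat)) (n : nat) : nat :=
  #|[pred p : 'S_n | `[< X (word p) >]]|.

Definition count_root (R : realType) (X : set (seq nat)) (n : nat) : \bar R :=
  (((count_length X n)%:R `^ (n%:R^-1))%:E)%R.

Definition proper_growth_rate (R : realType) (X : set (seq nat)) : Prop :=
  limn_einf (count_root R X) = limn_esup (count_root R X).

(* Meaningful when proper_growth_rate R X. *)
Definition gr (R : realType) (X : set (seq nat)) : \bar R :=
  limn_esup (count_root R X).

(* Main.v *)
Require Import Defs.
From mathcomp Require Import all_boot all_order all_algebra all_fingroup.
From mathcomp Require Import all_classical all_reals all_analysis.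
From mathcomp Require Import zify lra.

(** The inversion graph of [sigma m] is a path whose two leaves are the entries
inflated by [alpha].  Listing the blocks along this path gives
alpha, s_1, ..., s_(m-2), alpha, where s_1, ..., s_(m-2) is an arbitrary string
over the alphabet A_tau.

The string can be read off the inflation ([path_inflation_inj]).  In the
plane, the path zigzags: the positions follow the order 1, 0, 3, 2, 5, 4, ... of
the path and the values follow the order 0, 2, 1, 4, 3, 6, 5, ... .  Hence, once
blocks 0, ..., t are known, one of the two coordinates of block t is known, so its
entries can be located, and its other coordinate then reveals the size of block
t + 1.  The first block has the known size k + 1, so induction recovers all the
sizes, and with them all the blocks.

So, up to a shift by 2(k+1), the members of U of length n are counted by the
number G(n) of strings over A_tau of total length n ([count_length_U]).  The
alphabet has one word of length k-1 and N words of length k, N being the number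
of permutations of length k that avoid tau, whence G(n) = G(n-k+1) + N G(n-k).
Let r >= 1 be a root of r^k = r + N.  Induction gives G(n) <= r^n, and also
r^n <= r^D G(n) for large n, as soon as G is eventually positive.  Since k-1 and
k are coprime this holds when N > 0, which is the case for k > 2
([avoiders_gt0]); for k = 2 the length k-1 = 1 alone suffices.  The n-th roots of
the counts therefore converge to r ([cvg_count_root_U]).

Finally, a permutation of length k containing tau is obtained by inserting one
entry into tau, which can be done in at most k^2 ways, so N >= k! - k^2
([factorial_leq_avoiders]).  As r^k >= N, r exceeds any bound for k large. *)

Set Implicit Arguments.
Unset Strict Implicit.
Unset Printing Implicit Defensive.

(** * The path underlying an increasing oscillation *)

Local Ltac iflia := repeat case: ifP; lia.

Section PathCoordinates.

(** The entry at position [i] of [sigma m] is the [flip m i]-th vertex of the path,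
counted from the least entry; this correspondence is an involution. *)
Definition flip (m i : nat) : nat :=
  if odd i then i.-1 else if i.+1 == m then i else i.+1.

(** [below t u]: vertex [u] of the path has a smaller value than vertex [t].  Apart
from the range of [u] this does not depend on [m]: by value, the path visits
0, 2, 1, 4, 3, 6, 5, ... . *)
Definition below (t u : nat) : bool :=
  if odd t then (u < t) || (u == t.+1) else u < t.-1.

(** The value in [sigma m] of vertex [t] of the path. *)
Definition rank (m t : nat) : nat :=
  if odd t then t.+1 + (t.+1 < m) else maxn t 1.

Lemma flip_lt m i : i < m -> flip m i < m.
Proof. rewrite /flip; iflia. Qed.

Lemma flipK m i : i < m -> flip m (flip m i) = i.
Proof. rewrite /flip; iflia. Qed.

Lemma perm_flip m : perm_eq [seq flip m i | i <- iota 0 m] (iota 0 m).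
Proof.
apply: uniq_perm; rewrite ?iota_uniq //.
  rewrite map_inj_in_uniq ?iota_uniq // => i j.
  rewrite !mem_iota /= => im jm eq_f.
  by rewrite -(@flipK m i) ?eq_f ?flipK //; lia.
move=> i; rewrite mem_iota add0n /=; apply/mapP/idP.
  by case=> j; rewrite mem_iota add0n /= => jm ->; apply: flip_lt.
by move=> im; exists (flip m i); rewrite ?flipK // mem_iota add0n /= flip_lt.
Qed.

Lemma sum_flip m (P : pred nat) (f : nat -> nat) :
  \sum_(0 <= i < m | P (flip m i)) f (flip m i) = \sum_(0 <= t < m | P t) f t.
Proof.
rewrite /index_iota subn0 -(big_map (flip m) P f).
exact/perm_big/perm_flip.
Qed.

Lemma rank_lt m t u : t < m -> u < m -> (rank m u < rank m t) = below t u.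
Proof. rewrite /rank /below; iflia. Qed.

(** Letting [f] vanish beyond the path covers the last vertex, which may have no
successor. *)
Lemma sum_below m t (f : nat -> nat) : t < m -> (forall u, m <= u -> f u = 0) ->
  \sum_(0 <= u < m | below t u) f u =
    if odd t then \sum_(0 <= u < t) f u + f t.+1 else \sum_(0 <= u < t.-1) f u.
Proof.
move=> tm f0.
have -> : \sum_(0 <= u < m | below t u) f u = \sum_(0 <= u < m.+1 | below t u) f u.
  by rewrite [RHS]big_mkcond big_nat_recr //= f0 // if_same addn0 -big_mkcond.
rewrite /below; case: ifP => odd_t.
  rewrite big_mkcond (@big_cat_nat _ _ _ t.+2) //=.
  rewrite [X in _ + X]big1_seq ?addn0; last first.
    by move=> u; rewrite mem_index_iota => /andP[_ /andP[? ?]]; case: ifP => //; lia.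
  rewrite !big_nat_recr //= !ltnn eqxx orbT (negbTE (_ : t != t.+1)) ?addn0; last lia.
  rewrite addnC [RHS]addnC; congr (_ + _); rewrite !big_nat.
  by apply: eq_bigr => u /andP[_ ->].
rewrite big_mkcond (@big_cat_nat _ _ _ t.-1) //=; last lia.
rewrite [X in _ + X]big1_seq ?addn0; last first.
  by move=> u; rewrite mem_index_iota => /andP[_ /andP[? ?]]; case: ifP => //; lia.
rewrite !big_nat.
by apply: eq_bigr => u /andP[_ ->].
Qed.

(** The values 1, 4, 3, 6, 5, 8, ... of the oscillating sequence along its path. *)
Definition path_value (t : nat) : nat := if odd t then t + 3 else t + 1.

Lemma osc_entriesE m :
  osc_entries m = [seq path_value (flip m i) | i <- iota 0 m].
Proof.
rewrite /osc_entries; case: ifP => odd_m.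
  (* Of the last three terms only the middle one, of value m, passes the filter. *)
  have -> : m + 2 = m.-1 + 3 by lia.
  rewrite iotaD map_cat filter_cat.
  have -> : iota 0 m = iota 0 m.-1 ++ [:: m.-1].
    by rewrite -[in LHS](_ : m.-1 + 1 = m) ?iotaD //; lia.
  rewrite map_cat; congr (_ ++ _).
    rewrite (_ : iota 1 = iota (1 + 0)) // iotaDl -map_comp.
    rewrite (_ : [seq v <- _ | _] = [seq (oscillation \o addn 1) i | i <- iota 0 m.-1]).
      apply/eq_in_map => i; rewrite mem_iota /= => im.
      rewrite /oscillation /path_value /flip /=; iflia.
    apply/all_filterP/allP => v /mapP [i]; rewrite mem_iota /= => im ->.
    rewrite /oscillation /=; iflia.
  rewrite /= (_ : 1 + m.-1 = m); last lia.
  have -> : oscillation m <= m + 1 = false by rewrite /oscillation odd_m; lia.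
  have -> : oscillation m.+1 <= m + 1 by rewrite /oscillation /=; iflia.
  have -> : oscillation m.+2 <= m + 1 = false by rewrite /oscillation /=; iflia.
  by congr cons; rewrite /oscillation /path_value /flip /=; iflia.
rewrite (_ : iota 1 = iota (1 + 0)) // iotaDl -map_comp; apply/eq_in_map => i.
rewrite mem_iota /= => im; rewrite /oscillation /path_value /flip /=; iflia.
Qed.

Lemma size_sigma m : size (sigma m) = m.
Proof. by rewrite !size_map osc_entriesE size_map size_iota. Qed.

Lemma nth_sigma m i : i < m -> nth 0 (sigma m) i = rank m (flip m i).
Proof.
move=> im; have fm := flip_lt im.
rewrite /sigma /standardize osc_entriesE.
rewrite (nth_map 0) ?size_map ?size_iota // (nth_map 0) ?size_iota // nth_iota // add0n.
rewrite (map_comp path_value (flip m)) count_map (seq.permP (perm_flip m)).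
rewrite (@eq_in_count _ _ (below (flip m i))); last first.
  move=> u; rewrite mem_iota /= /path_value /below; iflia.
rewrite -sum1_count; move: (flip m i) fm => t tm.
rewrite (_ : \sum_(_ <- _ | _) 1 = \sum_(0 <= u < m | below t u) (u < m)); last first.
  by rewrite /index_iota subn0 [LHS]big_seq_cond [RHS]big_seq_cond;
     apply: eq_bigr => u; rewrite mem_iota /= => /andP [-> _].
rewrite sum_below //; last by move=> u; lia.
have sumE n : n <= m -> \sum_(0 <= u < n) (u < m) = n.
  move=> nm; rewrite big_nat (eq_bigr (fun=> 1)); last by move=> u; lia.
  by rewrite -big_nat sum_nat_const_nat muln1 subn0.
rewrite /rank; case: ifP => odd_t; rewrite sumE; lia.
Qed.

(** The entries to be inflated by [alpha] are the two leaves of the path, for both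
parities of [m]. *)
Lemma end_entryE m i : i < m ->
  end_entry m i = (flip m i == 0) || (flip m i == m.-1).
Proof.
move=> im; have fm := flip_lt im; rewrite /end_entry nth_sigma // /rank.
move: (flipK im); rewrite /flip; iflia.
Qed.

Lemma sigma_uniq m : uniq (sigma m).
Proof.
apply/(uniqP 0) => i j; rewrite !inE size_sigma => im jm.
rewrite !nth_sigma // => eq_r; rewrite -(flipK im) -(flipK jm); congr flip.
move: (flip_lt im) (flip_lt jm) eq_r; move: (flip m i) (flip m j) => t u.
rewrite /rank; iflia.
Qed.

End PathCoordinates.

(** * Inflations of permutations *)

Definition perm_word (w : seq nat) : bool := perm_eq w (iota 1 (size w)).

Section PermWord.

Variable w : seq nat.
Hypothesis w_perm : perm_word w.

Lemma perm_word_uniq : uniq w.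
Proof. by rewrite (perm_uniq w_perm) iota_uniq. Qed.

Lemma mem_perm_word v : (v \in w) = (0 < v <= size w).
Proof. by rewrite (perm_mem w_perm) mem_iota add1n ltnS. Qed.

Lemma nth_perm_word x : x < size w -> 0 < nth 0 w x <= size w.
Proof. by move=> xw; rewrite -mem_perm_word mem_nth. Qed.

End PermWord.

Lemma uniq_perm_word w : uniq w -> (forall v, v \in w -> 0 < v <= size w) -> perm_word w.
Proof.
move=> uniq_w le_w; apply: uniq_perm => //; first exact: iota_uniq.
have sub_w : {subset w <= iota 1 (size w)}.
  by move=> v /le_w; rewrite mem_iota add1n ltnS.
by apply: (uniq_min_size uniq_w sub_w _).2; rewrite size_iota.
Qed.

Section Inflation.

Variables (s : seq nat) (a : seq (seq nat)).

Lemma shape_inflation :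
  shape [seq [seq v + \sum_(0 <= j < size s | nth 0 s j < nth 0 s i)
                        size (nth [::] a j) | v <- nth [::] a i]
        | i <- iota 0 (size s)] = [seq size (nth [::] a i) | i <- iota 0 (size s)].
Proof. by rewrite /shape -map_comp; apply: eq_map => i /=; rewrite size_map. Qed.

Lemma size_inflation :
  size (inflation s a) = \sum_(0 <= i < size s) size (nth [::] a i).
Proof.
by rewrite size_flatten shape_inflation sumnE big_map /index_iota subn0.
Qed.

Lemma nth_inflation i x : i < size s -> x < size (nth [::] a i) ->
  let y := \sum_(0 <= j < i) size (nth [::] a j) + x in
  y < size (inflation s a) /\
  nth 0 (inflation s a) y =
    nth 0 (nth [::] a i) x +
    \sum_(0 <= j < size s | nth 0 s j < nth 0 s i) size (nth [::] a j).
Proof.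
move=> im xa y.
have yE : y = flatten_index [seq size (nth [::] a j) | j <- iota 0 (size s)] i x.
  rewrite /flatten_index -map_take take_iota sumnE big_map /y /index_iota subn0.
  by congr (\sum_(_ <- iota 0 _) _ + _); lia.
have xa' : x < nth 0 [seq size (nth [::] a j) | j <- iota 0 (size s)] i.
  by rewrite (nth_map 0) ?size_iota // nth_iota.
split.
  by rewrite size_flatten shape_inflation yE flatten_indexP.
rewrite /inflation nth_flatten shape_inflation yE flatten_indexKl // flatten_indexKr //.
by rewrite (nth_map 0) ?size_iota // nth_iota // add0n (nth_map 0).
Qed.

Let shift i := \sum_(0 <= j < size s | nth 0 s j < nth 0 s i) size (nth [::] a j).

(** The values of the block at [i] end at [shift i + size a_i]; taking for [P] the
indices of the entries below a larger entry shows that the value intervals of distinct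
blocks are disjoint, and taking all indices that they stay within the total length. *)
Lemma shift_add_leq i (P : pred nat) : i < size s -> P i ->
    (forall j, nth 0 s j < nth 0 s i -> P j) ->
  shift i + size (nth [::] a i) <= \sum_(0 <= j < size s | P j) size (nth [::] a j).
Proof.
move=> im Pi ltP.
have -> : size (nth [::] a i) = \sum_(0 <= j < size s | j == i) size (nth [::] a j).
  by rewrite big_nat1_eq im.
rewrite /shift !(big_mkcond _ (fun j => size _)) -big_split leq_sum // => j _ /=.
case: ltnP => [ji | ij].
  by rewrite (ltP _ ji); case: eqP ji => [-> | _]; rewrite ?ltnn ?addn0.
by case: eqP => [-> | _] //; rewrite Pi.
Qed.

Lemma inflation_perm : uniq s ->
  (forall i, i < size s -> perm_word (nth [::] a i)) -> perm_word (inflation s a).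
Proof.
move=> uniq_s a_perm.
have lt_shift i j (x y : nat) : i < size s -> j < size s -> nth 0 s i < nth 0 s j ->
    x \in nth [::] a i -> y \in nth [::] a j -> x + shift i < y + shift j.
  move=> im jm ij; rewrite !mem_perm_word ?a_perm // => /andP[_ xa] /andP[y0 _].
  have := @shift_add_leq i (fun u => nth 0 s u < nth 0 s j) im ij (fun u ui => ltn_trans ui ij).
  rewrite /= -/(shift j) => le_ij.
  rewrite (leq_ltn_trans (_ : _ <= shift j)) ?(leq_trans _ le_ij) //.
    by rewrite addnC leq_add2l.
  by rewrite -[X in X < _]add0n ltn_add2r.
apply: uniq_perm_word.
  apply: allpairs_uniq_dep; first exact: iota_uniq.
    by move=> i; rewrite mem_iota => /a_perm /perm_word_uniq.
  move=> _ _ /allpairsPdep [i [v [im va ->]]] /allpairsPdep [j [u [jm ua ->]]] /= eq_vu.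
  rewrite !mem_iota /= in im jm.
  have ij : i = j.
    apply/eqP; rewrite -(nth_uniq 0 im jm uniq_s) eqn_leq.
    by apply/andP; split; rewrite leqNgt; apply/negP => lt_s;
      [move: (lt_shift _ _ _ _ jm im lt_s ua va) | move: (lt_shift _ _ _ _ im jm lt_s va ua)];
      rewrite /shift -eq_vu ltnn.
  by subst j; move/addIn: eq_vu => ->.
move=> _ /allpairsPdep [i [v [im va ->]]].
rewrite mem_iota /= in im.
have := @shift_add_leq i predT im isT (fun _ _ => isT).
rewrite -size_inflation => le_i; move: va; rewrite mem_perm_word ?a_perm //.
move=> /andP[v0 va]; rewrite addn_gt0 v0 /= (leq_trans _ le_i) //.
by rewrite addnC leq_add2l.
Qed.

End Inflation.

(** * Inflations read along the path *)

(** The inflation of [sigma (size b)] whose blocks are listed along the path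
instead of by position. *)
Definition path_inflation (b : seq (seq nat)) : seq nat :=
  inflation (sigma (size b)) [seq nth [::] b (flip (size b) i) | i <- iota 0 (size b)].

Definition blocks (b : seq (seq nat)) : bool := all (fun w => perm_word w && (w != [::])) b.

Section PathInflation.

Variable b : seq (seq nat).

Definition bsize t := size (nth [::] b t).

Definition total_below t := \sum_(0 <= u < t) bsize u.

(** Vertices 0, ..., t - 1 precede an even vertex [t] in position, and so does vertex
t + 1; an odd vertex [t] comes just after vertices 0, ..., t - 2.  For values the two
parities are exchanged, vertex 0 being the least. *)
Definition pos_start t :=
  if odd t then total_below t.-1 else total_below t + bsize t.+1.

Definition val_start t :=
  if odd t then total_below t + bsize t.+1 else total_below t.-1.

Lemma bsize_default t : size b <= t -> bsize t = 0.
Proof. by move=> bt; rewrite /bsize nth_default. Qed.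

Lemma nth_flip_blocks i : i < size b ->
  nth [::] [seq nth [::] b (flip (size b) j) | j <- iota 0 (size b)] i =
  nth [::] b (flip (size b) i).
Proof. by move=> ib; rewrite (nth_map 0) ?size_iota // nth_iota. Qed.

(** Positions 2j and 2j + 1 hold vertices 2j + 1 and 2j, so the sum over the first [i]
positions is a prefix sum along the path up to one exchanged pair. *)
Lemma sum_pos_start i : i < size b ->
  \sum_(0 <= j < i) bsize (flip (size b) j) = pos_start (flip (size b) i).
Proof.
move=> ib.
have -> : \sum_(0 <= j < i) bsize (flip (size b) j) =
    if odd i then total_below i.-1 + bsize i else total_below i.
  elim: i ib => [|i IHi] ib; first by rewrite /total_below !big_geq.
  rewrite big_nat_recr //= IHi; last lia.
  rewrite /flip; case: ifP => odd_i /=.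
    case: i odd_i {IHi ib} => // i _.
    by rewrite /total_below !big_nat_recr //= addnAC.
  by rewrite ifF //; lia.
rewrite /pos_start; case: (boolP (odd i)) => odd_i.
  have -> : flip (size b) i = i.-1 by rewrite /flip odd_i.
  rewrite ifF; last lia.
  by rewrite prednK //; lia.
rewrite /flip (negbTE odd_i); case: eqP => [bi | _].
  by rewrite (negbTE odd_i) bsize_default ?addn0 // bi.
by rewrite /= odd_i.
Qed.

Lemma nth_path_inflation t x : x < bsize t ->
  pos_start t + x < size (path_inflation b) /\
  nth 0 (path_inflation b) (pos_start t + x) = val_start t + nth 0 (nth [::] b t) x.
Proof.
move=> xt; have tb : t < size b by rewrite ltnNge; apply: contraL xt => /bsize_default ->.
have fb := flip_lt tb; have ffE := flipK tb.
have := @nth_inflation (sigma (size b))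
  [seq nth [::] b (flip (size b) i) | i <- iota 0 (size b)] (flip (size b) t) x.
rewrite size_sigma nth_flip_blocks // ffE => /(_ fb xt) [].
rewrite -/(path_inflation b).
have -> : \sum_(0 <= j < flip (size b) t)
    size (nth [::] [seq nth [::] b (flip (size b) i) | i <- iota 0 (size b)] j) = pos_start t.
  rewrite -ffE -sum_pos_start ?ffE // !big_nat; apply: eq_bigr => j /andP[_ jt].
  by rewrite nth_flip_blocks // (ltn_trans jt fb).
have -> : \sum_(0 <= j < size b | nth 0 (sigma (size b)) j
                                 < nth 0 (sigma (size b)) (flip (size b) t))
    size (nth [::] [seq nth [::] b (flip (size b) i) | i <- iota 0 (size b)] j) = val_start t.
  transitivity (\sum_(0 <= j < size b | below t (flip (size b) j)) bsize (flip (size b) j)).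
    rewrite big_nat_cond [RHS]big_nat_cond; apply: eq_big => [j | j /andP[/andP[_ jb] _]].
      case: (ltnP j (size b)) => //= jb; rewrite !nth_sigma // ffE rank_lt //.
      exact: flip_lt.
    by rewrite nth_flip_blocks.
  by rewrite (sum_flip _ (below t) bsize) sum_below //; exact: bsize_default.
by rewrite [_ + val_start t]addnC.
Qed.

Lemma size_path_inflation : size (path_inflation b) = total_below (size b).
Proof.
rewrite size_inflation size_sigma /total_below -(sum_flip _ predT bsize).
rewrite !big_nat; apply: eq_bigr => j /andP[_ jb].
by rewrite nth_flip_blocks.
Qed.

Hypothesis b_blocks : blocks b.

Lemma block_perm t : perm_word (nth [::] b t).
Proof.
have [tb | bt] := ltnP t (size b); last by rewrite nth_default.
by have /(_ _ (mem_nth [::] tb))/andP[] := allP b_blocks.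
Qed.

Lemma bsize_gt0 t : (0 < bsize t) = (t < size b).
Proof.
have [tb | bt] := ltnP t (size b); last by rewrite bsize_default.
by have /(_ _ (mem_nth [::] tb))/andP[_] := allP b_blocks; rewrite -size_eq0 lt0n.
Qed.

Lemma path_inflation_perm : perm_word (path_inflation b).
Proof.
apply: inflation_perm; first exact: sigma_uniq.
by move=> i; rewrite size_sigma => ib; rewrite nth_flip_blocks // block_perm.
Qed.

End PathInflation.

Section Decoding.

Lemma eq_total_below b b' t : (forall u, u < t -> bsize b u = bsize b' u) ->
  total_below b t = total_below b' t.
Proof. by move=> eq_t; rewrite /total_below !big_nat; apply: eq_bigr => u /andP[_ /eq_t]. Qed.

(** For [t] odd, block [t] occupies the same positions in both inflations, and its
least value exceeds [bsize t.+1] by a quantity that depends on the earlier sizes only.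
For [t] even, block [t] has the same set of values in both, and its first position plays
the role of its least value. *)
Lemma next_bsize_leq b b' t : blocks b -> blocks b' ->
    path_inflation b = path_inflation b' ->
    (forall u, u <= t -> bsize b u = bsize b' u) ->
  bsize b t.+1 <= bsize b' t.+1.
Proof.
move=> bb bb' eq_w eq_t.
have [tb | bt] := ltnP t (size b); last by rewrite bsize_default // leqW.
have tb' : t < size b' by rewrite -bsize_gt0 // -eq_t // bsize_gt0.
have eqS : total_below b t = total_below b' t by apply: eq_total_below => u /ltnW/eq_t.
have eqS1 : total_below b t.-1 = total_below b' t.-1.
  by apply: eq_total_below => u ut; apply: eq_t; lia.
have t0 : 0 < bsize b t by rewrite bsize_gt0.
have t0' : 0 < bsize b' t by rewrite bsize_gt0.
case: (boolP (odd t)) => odd_t.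
  (* The least entry of the block of b', looked up in both inflations. *)
  have in1 : 1 \in nth [::] b' t by rewrite mem_perm_word ?block_perm.
  have x' : index 1 (nth [::] b' t) < bsize b' t by rewrite /bsize index_mem.
  have [_] := nth_path_inflation x'; have := x'; rewrite -eq_t // => x.
  have [_] := nth_path_inflation x; rewrite eq_w nth_index //.
  have /andP[pos_x _] := nth_perm_word (block_perm bb t) x.
  by rewrite /pos_start /val_start odd_t eqS1 eqS => ->; lia.
(* The first entry of the block of b', looked up in both inflations. *)
set v := nth 0 (nth [::] b' t) 0.
have vb : v \in nth [::] b t.
  rewrite mem_perm_word ?block_perm // -/(bsize b t) eq_t //.
  exact: (nth_perm_word (block_perm bb' t) t0').
have x : index v (nth [::] b t) < bsize b t by rewrite /bsize index_mem.
have [lt_y nth_y] := nth_path_inflation x.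
have [lt_y' nth_y'] := nth_path_inflation t0'.
have uniq_w := perm_word_uniq (path_inflation_perm bb).
have /eqP : pos_start b t + index v (nth [::] b t) == pos_start b' t + 0.
  rewrite -(nth_uniq 0 lt_y _ uniq_w) eq_w // nth_y' -eq_w nth_y nth_index //.
  by rewrite /val_start (negbTE odd_t) eqS1.
rewrite /pos_start (negbTE odd_t) eqS; lia.
Qed.

(** Once all block sizes agree, so do the places of the blocks, hence the blocks. *)
Lemma path_inflation_inj b b' : blocks b -> blocks b' -> bsize b 0 = bsize b' 0 ->
  path_inflation b = path_inflation b' -> b = b'.
Proof.
move=> bb bb' eq0 eq_w.
have eq_size t : bsize b t = bsize b' t.
  suff: forall u, u <= t -> bsize b u = bsize b' u by apply.
  elim: t => [|t IHt] u; first by rewrite leqn0 => /eqP ->.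
  rewrite leq_eqVlt ltnS => /orP[/eqP -> | /IHt //].
  apply/eqP; rewrite eqn_leq !next_bsize_leq // => v /IHt //.
have eqS t : total_below b t = total_below b' t by apply: eq_total_below.
have eq_lt t : (t < size b) = (t < size b') by rewrite -!bsize_gt0 // eq_size.
have eq_len : size b = size b'.
  by case: (ltngtP (size b) (size b')) => // lt_b;
    [move: (lt_b); rewrite -eq_lt ltnn | move: (lt_b); rewrite eq_lt ltnn].
apply: (@eq_from_nth _ [::]) => // t tb.
apply: (@eq_from_nth _ 0) => [|x xt]; first exact: eq_size.
have [_] := nth_path_inflation (xt : x < bsize b t).
have xt' : x < bsize b' t by rewrite -eq_size.
have [_] := nth_path_inflation xt'.
rewrite eq_w /pos_start /val_start !eqS !eq_size => -> /eqP.
by rewrite eqn_add2l eq_sym => /eqP.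
Qed.

End Decoding.

(** * Words of permutations and strings of words *)

Section Words.

Lemma size_word n (p : 'S_n) : size (word p) = n.
Proof. by rewrite size_map size_enum_ord. Qed.

Lemma nth_word n (p : 'S_n) (i : 'I_n) : nth 0 (word p) i = (p i).+1.
Proof. by rewrite (nth_map i) ?size_enum_ord // nth_ord_enum. Qed.

Lemma word_inj n : injective (@word n).
Proof.
move=> p q eq_pq; apply/permP => i; apply: val_inj; apply: succn_inj.
by rewrite -!nth_word eq_pq.
Qed.

Lemma word_perm n (p : 'S_n) : perm_word (word p).
Proof.
apply: uniq_perm_word; last first.
  by move=> v /mapP [i _ ->]; rewrite size_word /= ltn_ord.
rewrite map_inj_uniq ?enum_uniq // => i j [] /val_inj; exact: perm_inj.
Qed.

Lemma perm_word_is_word n w : perm_word w -> size w = n -> exists p : 'S_n, word p = w.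
Proof.
move=> w_perm wn; pose f (i : 'I_n) := insubd i (nth 0 w i).-1.
have fE i : (f i).+1 = nth 0 w i.
  have wi : i < size w by rewrite wn.
  have := nth_perm_word w_perm wi; rewrite /f val_insubd wn => /andP[w0 wl].
  by rewrite ifT prednK.
have f_inj : injective f.
  move=> i j eq_f; have /eqP : nth 0 w i = nth 0 w j by rewrite -!fE eq_f.
  by rewrite nth_uniq ?wn ?perm_word_uniq // => /eqP /val_inj.
exists (perm f_inj); apply: (@eq_from_nth _ 0); rewrite size_word // => i i_n.
by rewrite (nth_word _ (Ordinal i_n)) permE fE.
Qed.

End Words.

Section Strings.

Variable L : seq (seq nat).

(** The strings over [L] whose words have total length [n], found with at most
[fuel] words; since words are nonempty, [n] words are enough. *)
Fixpoint strings_upto (fuel n : nat) : seq (seq (seq nat)) :=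
  if n == 0 then [:: [::]] else
  if fuel is f.+1 then
    [seq w :: s | w <- [seq w <- L | size w <= n], s <- strings_upto f (n - size w)]
  else [::].

Definition strings n := strings_upto n n.

Hypotheses (L_uniq : uniq L) (L_nil : [::] \notin L).

Lemma letter_size_gt0 w : w \in L -> 0 < size w.
Proof. by case: w => // w0L; move: L_nil; rewrite w0L. Qed.

Lemma sub_letter_leq w n f : w \in L -> n <= f.+1 -> n - size w <= f.
Proof. by move=> /letter_size_gt0; move: (size w) => k; lia. Qed.

Lemma mem_strings_upto f n s : n <= f ->
  (s \in strings_upto f n) = all [in L] s && (size (flatten s) == n).
Proof.
elim: f n s => [|f IHf] n s nf.
  have -> : n = 0 by lia.
  case: s => [|w s] //=; rewrite inE /=; apply/esym/negP.
  by case/andP=> /andP[/letter_size_gt0 w0 _]; rewrite size_cat addn_eq0 -leqn0 leqNgt w0.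
rewrite /=; case: eqP => [-> | /eqP n0].
  case: s => [|w s] //=; rewrite inE /=; apply/esym/negP.
  by case/andP=> /andP[/letter_size_gt0 w0 _]; rewrite size_cat addn_eq0 -leqn0 leqNgt w0.
apply/allpairsPdep/idP => [[w [s' [wL s'L ->]]] /= | ].
  move: wL s'L; rewrite mem_filter => /andP[wn wL].
  rewrite IHf; last exact: sub_letter_leq.
  by case/andP=> -> /eqP s'n; rewrite wL size_cat s'n subnKC /=.
case: s => [|w s] /=; first by move=> /eqP n0'; rewrite -n0' in n0.
case/andP=> /andP[wL sL]; rewrite size_cat => /eqP wsn.
exists w, s; split => //; first by rewrite mem_filter wL andbT -wsn leq_addr.
rewrite IHf; first by rewrite sL -wsn addKn eqxx.
exact: sub_letter_leq.
Qed.

Lemma strings_upto_uniq f n : uniq (strings_upto f n).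
Proof.
elim: f n => [|f IHf] n /=; case: eqP => // _.
apply: allpairs_uniq_dep; [exact: filter_uniq | by move=> w _; exact: IHf |].
by move=> [w s] [w' s'] _ _ /= [-> ->].
Qed.

Lemma size_strings_upto f n : n <= f -> size (strings_upto f n) = size (strings n).
Proof.
move=> nf; apply/perm_size/uniq_perm; rewrite ?strings_upto_uniq // => s.
by rewrite !mem_strings_upto.
Qed.

Lemma size_strings0 : size (strings 0) = 1.
Proof. by []. Qed.

(** Sorting the strings by their first word. *)
Lemma size_stringsE n : 0 < n ->
  size (strings n) = \sum_(w <- L | size w <= n) size (strings (n - size w)).
Proof.
case: n => // n _; rewrite /strings /= size_allpairs_dep sumnE big_map big_filter.
rewrite big_seq_cond [RHS]big_seq_cond; apply: eq_bigr => w /andP[wL wn].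
exact/size_strings_upto/sub_letter_leq.
Qed.

End Strings.

(** * The members of U as strings *)

Section Chains.

Variables (A : set (seq nat)) (L : seq (seq nat)) (alpha : seq nat) (k : nat).
Hypothesis AL : forall w, A w <-> w \in L.
Hypotheses (L_uniq : uniq L) (L_block : blocks L) (L_size : {in L, forall w, size w <= k}).
Hypotheses (alpha_perm : perm_word alpha) (alpha_nil : alpha != [::]).

Definition chain (s : seq (seq nat)) : seq nat := path_inflation (alpha :: rcons s alpha).

(** Between words by position and words along the path one translates by [flip],
which is its own inverse. *)
Lemma U_chain w : U A alpha w <-> exists s, [/\ 1 < size s, all [in L] s & w = chain s].
Proof.
split=> [[m [a [m4 am aA ->]]] | [s [s2 sL ->]]].
  pose b := [seq nth [::] a (flip m t) | t <- iota 0 m].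
  pose s := [seq nth [::] a (flip m t) | t <- iota 1 (m - 2)].
  have nth_end t : t < m -> (t == 0) || (t == m.-1) -> nth [::] a (flip m t) = alpha.
    move=> tm t_end; have := aA _ (flip_lt tm).
    by rewrite end_entryE ?flip_lt // flipK // t_end.
  have bE : b = alpha :: rcons s alpha.
    rewrite /b; have -> : m = 1 + ((m - 2) + 1) by lia.
    rewrite iotaD map_cat iotaD map_cat /= -cats1.
    have -> : 1 + ((m - 2) + 1) = m by lia.
    congr (_ :: (_ ++ [:: _])); apply: nth_end; lia.
  exists s; split.
  - by rewrite size_map size_iota; lia.
  - apply/allP => _ /mapP [t + ->]; rewrite mem_iota => tm.
    have tm' : t < m by lia.
    have := aA _ (flip_lt tm'); rewrite end_entryE ?flip_lt // flipK // ifF ?AL //; lia.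
  rewrite /chain -bE /path_inflation size_map size_iota; congr inflation.
  apply: (@eq_from_nth _ [::]); first by rewrite size_map size_iota.
  move=> i; rewrite am => im.
  rewrite (nth_map 0) ?size_iota // nth_iota // add0n.
  by rewrite (nth_map 0) ?size_iota ?flip_lt // nth_iota ?flip_lt // add0n flipK.
pose m := (size s).+2; pose b := alpha :: rcons s alpha.
have bm : size b = m by rewrite /= size_rcons.
exists m, [seq nth [::] b (flip m i) | i <- iota 0 m]; split.
- by rewrite /m; lia.
- by rewrite size_map size_iota.
- move=> i im; rewrite (nth_map 0) ?size_iota // nth_iota // add0n end_entryE //.
  have := flip_lt im; move: (flip m i) => [|t] //= tm.
  rewrite eqSS nth_rcons; case: eqP => [-> | nts]; first by rewrite ltnn.
  have ts : t < size s by move: tm; rewrite /m !ltnS leq_eqVlt => /orP[/eqP|].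
  by rewrite ts; apply/AL/(allP sL)/mem_nth.
- by rewrite /chain -/b /path_inflation bm.
Qed.

Lemma chain_blocks s : all [in L] s -> blocks (alpha :: rcons s alpha).
Proof.
move=> sL; rewrite /blocks /= all_rcons alpha_perm alpha_nil /=.
by apply/allP => w /(allP sL) /(allP L_block).
Qed.

Lemma size_chain s : size (chain s) = size (flatten s) + (size alpha).*2.
Proof.
rewrite size_path_inflation /total_below.
transitivity (\sum_(w <- alpha :: rcons s alpha) size w).
  by rewrite (big_nth [::]).
by rewrite big_cons big_rcons /= size_flatten sumnE big_map; lia.
Qed.

Lemma chain_inj s s' : all [in L] s -> all [in L] s' -> chain s = chain s' -> s = s'.
Proof.
move=> sL sL' /path_inflation_inj.
by move=> /(_ (chain_blocks sL) (chain_blocks sL') erefl) [] /rcons_inj [].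
Qed.

Lemma L_nil : [::] \notin L.
Proof. by apply/negP => /(allP L_block). Qed.

Lemma size_flatten_leq s : all [in L] s -> size (flatten s) <= k * size s.
Proof.
elim: s => //= w s IHs /andP[/L_size wk /IHs].
by rewrite size_cat mulnS; apply: leq_add.
Qed.

(** The bound on [n] leaves a total length of more than [k] to the inner words, so
there are at least two of these, as [4 <= m] demands. *)
Lemma count_length_U n : (size alpha).*2 + k < n ->
  count_length (U A alpha) n = size (strings L (n - (size alpha).*2)).
Proof.
move=> n_gt; rewrite /count_length cardE -(size_map (@word n)) -[RHS](size_map chain).
apply/perm_size/uniq_perm.
- by rewrite map_inj_uniq ?enum_uniq //; exact: word_inj.
- rewrite map_inj_in_uniq ?strings_upto_uniq // => s s'.
  by rewrite !mem_strings_upto ?L_nil // => /andP[sL _] /andP[sL' _]; exact: chain_inj.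
move=> w; apply/mapP/mapP => [[p + ->] | [s + ->]].
  rewrite mem_enum inE => /U_chain [s [s2 sL wE]].
  exists s => //; rewrite mem_strings_upto ?L_nil // sL /=.
  by rewrite -(size_word p) wE size_chain addnK.
rewrite mem_strings_upto ?L_nil // => /andP[sL /eqP s_size].
have chain_n : size (chain s) = n by rewrite size_chain s_size; lia.
have [p pE] := perm_word_is_word (path_inflation_perm (chain_blocks sL)) chain_n.
exists p => //; rewrite mem_enum inE; apply/U_chain; exists s; split => //.
have := size_flatten_leq sL; rewrite s_size => le_k.
by rewrite ltnNge; apply/negP => s1; nia.
Qed.

End Chains.

(** * Permutations avoiding a pattern that is shorter by one *)

Section Avoiders.

(** Entries are determined by their ranks: the number of smaller entries is preserved
by [same_order], and it tells the elements of a common set apart. *)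
Lemma same_order_perm_eq u u' : uniq u -> same_order u u' -> perm_eq u u' -> u = u'.
Proof.
move=> uniq_u [eq_size eq_lt] eq_uu'.
have countE w x : count (fun z => z < x) w = \sum_(0 <= j < size w) (nth 0 w j < x).
  by rewrite -sum1_count big_mkcond (big_nth 0); apply: eq_bigr => j _; case: ltnP.
have count_lt (x y : nat) : x \in u -> x < y -> count (fun z => z < x) u < count (fun z => z < y) u.
  move=> xu xy; have := count_predUI (fun z => z < x) (pred1 x) u.
  rewrite (@eq_count _ (predI _ _) pred0) ?count_pred0 ?addn0; last first.
    by move=> z /=; case: eqP => [-> | _]; rewrite ?ltnn ?andbF.
  have : 0 < count (pred1 x) u by rewrite -has_count has_pred1.
  have /sub_count/(_ u) : subpred (predU (fun z => z < x) (pred1 x)) (fun z => z < y).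
    by move=> z /orP[/= /ltn_trans-> // | /eqP -> //].
  by move=> le_y x_pos eq_c; apply: leq_trans le_y; rewrite eq_c -[X in X < _]addn0 ltn_add2l.
apply: (@eq_from_nth _ 0) => // i ui.
have eq_count_i : count (fun z => z < (nth 0 u i)) u = count (fun z => z < (nth 0 u' i)) u.
  rewrite [RHS](seq.permP eq_uu') !countE -eq_size !big_nat.
  by apply: eq_bigr => j /andP[_ ju]; rewrite eq_lt.
have u'i : nth 0 u' i \in u by rewrite (perm_mem eq_uu') mem_nth // -eq_size.
have [lt_i | lt_i | //] := ltngtP (nth 0 u i) (nth 0 u' i).
  by have := count_lt _ _ (mem_nth 0 ui) lt_i; rewrite eq_count_i ltnn.
by have := count_lt _ _ u'i lt_i; rewrite eq_count_i ltnn.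
Qed.

Lemma subseq_insert (T : eqType) (u w : seq T) : subseq u w -> size w = (size u).+1 ->
  exists i v, i <= size u /\ w = take i u ++ v :: drop i u.
Proof.
elim: w u => [|x w IHw] [|y u] //=.
  by move=> _ [] /size0nil ->; exists 0, x.
case: eqP => [-> sub_u [size_w] | _ sub_u [size_w]].
  by have [i [v [iu ->]]] := IHw _ sub_u size_w; exists i.+1, v.
exists 0, x; split => //=; congr cons.
by apply/esym/eqP; have := size_subseq_leqif sub_u; rewrite /= size_w => -[_ <-].
Qed.

Variables (k : nat) (tau : 'S_k.-1).

Definition avoiders : pred 'S_k := [pred p | `[< ~ contained (word tau) (word p) >]].

(** The first two entries of [tau] form an ascent or a descent; the decreasing,
respectively the increasing, permutation does not contain that pattern. *)
Lemma avoiders_gt0 : 2 < k -> 0 < #|avoiders|.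
Proof.
move=> k3.
have avoidW (r : rel nat) w : transitive r -> sorted r w -> perm_word w -> size w = k ->
    (forall x y, r x y -> (nth 0 (word tau) 0 < nth 0 (word tau) 1) != (x < y)) ->
  0 < #|avoiders|.
  move=> r_trans r_sorted w_perm w_size r_lt.
  have [p pE] := perm_word_is_word w_perm w_size; apply/card_gt0P; exists p.
  rewrite inE => -[u sub_u [size_u /(_ 0 1)]]; rewrite size_word => eq_lt.
  rewrite pE in sub_u; rewrite size_word in size_u.
  have := subseq_sorted r_trans sub_u r_sorted.
  case: u {sub_u} size_u eq_lt => [|x [|y u]] /=; try lia.
  move=> _ eq_lt /andP[/r_lt]; rewrite eq_lt ?eqxx //; lia.
case: (ltnP (nth 0 (word tau) 0) (nth 0 (word tau) 1)) => lt_tau.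
  apply: (avoidW gtn (rev (iota 1 k))).
  - exact/rev_trans/ltn_trans.
  - by rewrite rev_sorted iota_ltn_sorted.
  - by rewrite /perm_word size_rev size_iota perm_rev.
  - by rewrite size_rev size_iota.
  - by move=> x y; rewrite lt_tau /gtn /= => xy; rewrite ltnNge ltnW.
apply: (avoidW ltn (iota 1 k)).
- exact: ltn_trans.
- exact: iota_ltn_sorted.
- by rewrite /perm_word size_iota.
- by rewrite size_iota.
- by move=> x y xy; rewrite ltnNge lt_tau (xy : x < y).
Qed.

(** [p] arises from [tau] by inserting an entry of value [iv.2] at position [iv.1],
counting both from 0, and raising the values from [iv.2] on. *)
Definition extends (p : 'S_k) (iv : 'I_k * 'I_k) : Prop :=
  exists2 u, same_order (word tau) u & word p = take iv.1 u ++ iv.2.+1 :: drop iv.1 u.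

Lemma extends_inj p p' iv : extends p iv -> extends p' iv -> p = p'.
Proof.
case=> u [size_u lt_u] pE [u' [size_u' lt_u'] p'E].
have perm_u (q : 'S_k) v : word q = take iv.1 v ++ iv.2.+1 :: drop iv.1 v ->
    perm_eq (iv.2.+1 :: v) (iota 1 k).
  move=> qE; have := word_perm q; rewrite /perm_word size_word; apply: perm_trans.
  by rewrite qE -{1}(cat_take_drop iv.1 v) -cat1s perm_catCA.
have uu' : perm_eq u u'.
  rewrite -(perm_cons iv.2.+1); apply: perm_trans (perm_u _ _ pE) _.
  by rewrite perm_sym (perm_u _ _ p'E).
have uniq_u : uniq u by have := perm_uniq (perm_u _ _ pE); rewrite iota_uniq => /andP[].
suff eq_u : u = u' by apply: word_inj; rewrite pE p'E eq_u.
apply: same_order_perm_eq => //; split=> [|i j iu ju]; first by rewrite -size_u.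
by rewrite -lt_u ?size_u // lt_u' // size_u.
Qed.

Lemma contained_extends p : 0 < k -> contained (word tau) (word p) ->
  exists iv, extends p iv.
Proof.
move=> k0 [u sub_u tau_u]; have [size_u _] := tau_u; rewrite size_word in size_u.
have size_p : size (word p) = (size u).+1 by rewrite size_word -size_u prednK.
have [i [v [iu pE]]] := subseq_insert sub_u size_p.
have ik : i < k by rewrite -(prednK k0) size_u ltnS.
have : v \in word p by rewrite pE mem_cat inE eqxx orbT.
rewrite mem_perm_word ?word_perm // size_word => /andP[v0 vk].
have vk' : v.-1 < k by rewrite prednK.
by exists (Ordinal ik, Ordinal vk'); exists u; rewrite //= prednK.
Qed.

(** A permutation that contains [tau] is determined by the position and the value of
its one remaining entry. *)
Lemma factorial_leq_avoiders : 0 < k -> k`! <= #|avoiders| + k ^ 2.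
Proof.
move=> k0; rewrite -card_Sn -(cardC avoiders) leq_add2l.
pose f iv := odflt 1%g [pick p : 'S_k | `[< extends p iv >]].
have sub_f : [predC avoiders] \subset f @: [set: 'I_k * 'I_k].
  apply/fintype.subsetP => p; rewrite !inE => /asboolPn /contrapT /(contained_extends k0) [iv p_iv].
  apply/imsetP; exists iv => //; rewrite /f; case: pickP => [q /asboolP q_iv | /(_ p)] /=.
    exact: extends_inj p_iv q_iv.
  by move/asboolP.
apply: leq_trans (subset_leq_card sub_f) _; apply: leq_trans (leq_imset_card _ _) _.
by rewrite cardsT card_prod card_ord.
Qed.

End Avoiders.

Section Letters.

Variables (k : nat) (tau : 'S_k.-1).

Definition letters : seq (seq nat) :=
  word tau :: [seq word p | p <- enum (avoiders tau)].

Lemma A_letters w : A_ tau w <-> w \in letters.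
Proof.
rewrite inE /A_ /=; split.
  case=> [-> | [p p_av ->]]; first by rewrite eqxx.
  by rewrite map_f ?orbT // mem_enum inE.
case/orP=> [/eqP | /mapP [p]]; first by left.
by rewrite mem_enum inE => p_av ->; right; exists p.
Qed.

Hypothesis k_ge2 : 2 <= k.

Lemma letters_uniq : uniq letters.
Proof.
rewrite /= map_inj_uniq ?enum_uniq ?andbT; last exact: word_inj.
apply/negP => /mapP [p _ /(congr1 size)]; rewrite !size_word; lia.
Qed.

Lemma letters_size : {in letters, forall w, size w <= k}.
Proof.
move=> w; rewrite inE => /orP[/eqP -> | /mapP [p _ ->]]; rewrite size_word //; lia.
Qed.

Lemma letters_blocks : blocks letters.
Proof.
apply/allP => w; rewrite inE -size_eq0 => /orP[/eqP -> | /mapP [p _ ->]];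
  rewrite word_perm size_word; lia.
Qed.

Lemma size_strings_letters n : 0 < n ->
  size (strings letters n) =
    (if k.-1 <= n then size (strings letters (n - k.-1)) else 0) +
    #|avoiders tau| * (if k <= n then size (strings letters (n - k)) else 0).
Proof.
move=> n0; rewrite size_stringsE ?L_nil ?letters_blocks ?letters_uniq // big_mkcond big_cons.
rewrite size_word big_map (eq_bigr (fun=> if k <= n then size (strings letters (n - k)) else 0));
  last by move=> p _; rewrite size_word.
by rewrite big_const_seq count_predT iter_addn_0 mulnC -cardE.
Qed.

End Letters.

(** * Growth of the sequence of counts *)

Section GrowthOfRecurrence.

Import Order.TTheory GRing.Theory Num.Theory.
Import numFieldNormedType.Exports.
Local Open Scope classical_set_scope.
Local Open Scope ring_scope.

Variable R : realType.

Lemma cvg_root_cst (C : R) : 0 < C -> C `^ n%:R^-1 @[n --> \oo] --> (1 : R).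
Proof.
move=> C0.
have cvg0 : (n%:R : R)^-1 * ln C @[n --> \oo] --> (0 : R).
  rewrite -[X in _ --> X](mul0r (ln C)); apply: cvgM; last exact: cvg_cst.
  apply/(gtr0_cvgV0 (f := fun n => n%:R)); last exact: cvgr_idn.
  by near=> n; rewrite ltr0n; near: n; exists 1%N.
rewrite -[X in _ --> X]expR0; under eq_fun do rewrite /powR gt_eqF //.
exact: cvg_comp cvg0 (@continuous_expR R 0).
Unshelve. all: by end_near. Qed.

(** The constant [C] disappears because its n-th root tends to 1. *)
Lemma cvg_root (u : nat -> R) (r C : R) (n0 : nat) : 0 < r -> 0 < C ->
    (forall n, (n0 <= n)%N -> u n <= r ^+ n <= C * u n) ->
  u n `^ n%:R^-1 @[n --> \oo] --> r.
Proof.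
move=> r0 C0 u_r.
have rootK n : (0 < n)%N -> (r ^+ n) `^ n%:R^-1 = r.
  move=> n_gt0; rewrite -powR_mulrn ?ltW // -powRrM mulfV ?powRr1 ?ltW //.
  by rewrite pnatr_eq0 -lt0n.
apply: (@squeeze_cvgr _ _ _ _ (fun n => r / C `^ n%:R^-1) (fun=> r)).
- near=> n; have n_gt0 : (0 < n)%N by near: n; exists 1%N.
  have /u_r /andP[u_le le_u] : (n0 <= n)%N by near: n; exists n0.
  have u_ge0 : 0 <= u n by rewrite -(pmulr_rge0 _ C0) (le_trans _ le_u) // exprn_ge0 // ltW.
  have n_ge0 : 0 <= (n%:R : R)^-1 by rewrite invr_ge0.
  rewrite ler_pdivrMr ?powR_gt0 // mulrC -powRM ?(ltW C0) // -{1 2}(rootK n n_gt0).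
  by rewrite !ge0_ler_powR // nnegrE ?mulr_ge0 ?exprn_ge0 // ltW.
- rewrite -[X in _ --> X]divr1; apply: cvgM; first exact: cvg_cst.
  by apply: cvgV; [exact: oner_neq0 | exact: cvg_root_cst].
- exact: cvg_cst.
Unshelve. all: by end_near. Qed.

(** The polynomial X^k - X - N is at most 0 at 1 and at least 0 at N + 2, because
(N + 2)^k >= (N + 2)^2 >= 2 N + 2. *)
Lemma characteristic_root (k N : nat) : (2 <= k)%N ->
  exists2 r : R, 1 <= r & r ^+ k = r + N%:R.
Proof.
move=> k2; pose p : {poly R} := 'X^k - 'X - N%:R%:P.
have pE x : p.[x] = x ^+ k - x - N%:R by rewrite !hornerE.
have le_1N : 1 <= N%:R + 2%:R :> R by rewrite -natrD ler1n addn2.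
have /poly_ivt [//|r /andP[r1 _]] : p.[1] <= 0 <= p.[N%:R + 2%:R].
  rewrite !pE expr1n subrr sub0r oppr_le0 ler0n /= subr_ge0 lerBrDr.
  apply: le_trans (_ : (N%:R + 2%:R) ^+ 2 <= _); last by rewrite ler_weXn2l.
  by have := ler0n R N; nra.
by rewrite rootE pE => /eqP p0; exists r => //; lra.
Qed.

Variables (k N : nat) (G : nat -> nat).
Hypotheses (k_ge2 : (2 <= k)%N) (kN : (k == 2) || (0 < N)%N) (G0 : G 0 = 1%N).
Hypothesis G_rec : forall n, (0 < n)%N ->
  G n = ((if k.-1 <= n then G (n - k.-1) else 0) + N * (if k <= n then G (n - k) else 0))%N.

Variable r : R.
Hypotheses (r_ge1 : 1 <= r) (r_root : r ^+ k = r + N%:R).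

Lemma recurrence_leq n : (G n)%:R <= r ^+ n.
Proof.
have r0 : 0 < r by apply: lt_le_trans r_ge1.
elim/ltn_ind: n => -[|n] IHn; first by rewrite G0 expr0.
rewrite G_rec // natrD natrM; case: (leqP k.-1 n.+1) => kn1; last first.
  by rewrite ifF ?mulr0 ?addr0 ?exprn_ge0 ?ltW //; lia.
have IH1 : (G (n.+1 - k.-1))%:R <= r ^+ (n.+1 - k.-1) by apply: IHn; lia.
case: (leqP k n.+1) => kn; last first.
  rewrite mulr0 addr0 (le_trans IH1) // ler_weXn2l //; lia.
have IH2 : (G (n.+1 - k))%:R <= r ^+ (n.+1 - k) by apply: IHn; lia.
rewrite -[in leRHS](subnKC kn) exprD r_root mulrDl -exprS.
have -> : (n.+1 - k).+1 = (n.+1 - k.-1)%N by lia.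
by rewrite lerD // ler_wpM2l.
Qed.

(** Writing n = q (k-1) + s with s < k-1 <= q gives n = (q-s) (k-1) + s k, a
combination of the two steps of the recurrence; if [k = 2] then [s = 0]. *)
Lemma recurrence_gt0 n : (k.-1 ^ 2 <= n)%N -> (0 < G n)%N.
Proof.
have step1 m : (0 < G m)%N -> (0 < G (m + k.-1))%N.
  move=> Gm; rewrite G_rec; last lia.
  by rewrite leq_addl addnK ltn_addr.
have stepk m : (0 < N)%N -> (0 < G m)%N -> (0 < G (m + k))%N.
  move=> N0 Gm; rewrite (G_rec (_ : 0 < m + k)%N); last lia.
  by rewrite leq_addl addnK ltn_addl // muln_gt0 N0.
have combi a b : (b == 0)%N || (0 < N)%N -> (0 < G (a * k.-1 + b * k))%N.
  move=> bN; elim: a => [|a IHa]; last by rewrite mulSnr addnAC; apply: step1.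
  rewrite mul0n add0n; elim: b bN => [|b IHb] //=; first by rewrite G0.
  by move=> N0; rewrite mulSnr; apply: stepk => //; apply: IHb; rewrite N0 orbT.
move=> nk.
have [q [s [nE [sk]]]] : exists q s, n = (q * k.-1 + s)%N /\ (s < k.-1)%N /\ (s <= q)%N.
  exists (n %/ k.-1)%N, (n %% k.-1)%N; rewrite -divn_eq ltn_mod; do !split; try lia.
  apply: leq_trans (_ : k.-1 <= _)%N; last by rewrite leq_divRL ?mulnn; lia.
  by rewrite ltnW // ltn_mod; lia.
move=> sq; have -> : n = ((q - s) * k.-1 + s * k)%N.
  by rewrite nE -[in RHS](prednK (_ : 0 < k)%N); [nia | lia].
apply: combi; case/orP: kN => [/eqP k2|->]; rewrite ?orbT //.
by move: sk; rewrite k2; case: (s).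
Qed.

(* The recurrence looks back at most k terms, so the lower bound propagates from
   the k terms that follow the positivity threshold; there r^n <= r^D. *)
Let D := (k.-1 ^ 2 + k)%N.

Lemma recurrence_geq n : (k.-1 ^ 2 <= n)%N -> r ^+ n <= r ^+ D * (G n)%:R.
Proof.
have r0 : 0 < r by apply: lt_le_trans r_ge1.
elim/ltn_ind: n => n IHn nk; case: (ltnP n D) => nD.
  apply: le_trans (_ : r ^+ D <= _); first by rewrite ler_weXn2l // ltnW.
  by rewrite ler_peMr ?(exprn_ge0 _ (ltW r0)) // ler1n recurrence_gt0.
have kn : (k <= n)%N by rewrite (leq_trans _ nD) // leq_addl.
have kn2 : (k.-1 ^ 2 <= n - k)%N by rewrite leq_subRL // addnC.
rewrite G_rec; last by rewrite (leq_trans _ kn) // (leq_trans _ k_ge2).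
rewrite kn (leq_trans (leq_pred k) kn) natrD natrM mulrDr mulrCA.
rewrite -[in leLHS](subnKC kn) exprD r_root mulrDl -exprS.
have eq_k1 : (n - k).+1 = (n - k.-1)%N by lia.
rewrite eq_k1 lerD // ?ler_wpM2l //; apply: IHn; lia.
Qed.

Lemma cvg_recurrence_root (d : nat) :
  (G (n - d))%:R `^ n%:R^-1 @[n --> \oo] --> r.
Proof.
have r0 : 0 < r by apply: lt_le_trans r_ge1.
apply: (@cvg_root _ r (r ^+ (d + D)) (d + k.-1 ^ 2)) => // [|n nd].
  by rewrite exprn_gt0.
apply/andP; split.
  by rewrite (le_trans (recurrence_leq _)) // ler_weXn2l // leq_subr.
have dn : (d <= n)%N by rewrite (leq_trans _ nd) // leq_addr.
rewrite -[in leLHS](subnKC dn) !(exprD _ d) -mulrA ler_wpM2l ?(exprn_ge0 _ (ltW r0)) //.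
by apply: recurrence_geq; rewrite leq_subRL.
Qed.

End GrowthOfRecurrence.

(** * The growth rate of U *)

Section GrowthRate.

Import Order.TTheory GRing.Theory Num.Theory.
Import numFieldNormedType.Exports.
Local Open Scope classical_set_scope.
Local Open Scope ring_scope.

Variable R : realType.

Lemma cvg_count_root_U (k : nat) (tau : 'S_k.-1) (alpha : 'S_k.+1) : (2 <= k)%N ->
  exists r : R, [/\ 1 <= r, r ^+ k = r + #|avoiders tau|%:R &
    count_root R (U (A_ tau) (word alpha)) @ \oo --> r%:E].
Proof.
move=> k2; have [r r1 r_root] := @characteristic_root R k #|avoiders tau| k2.
exists r; split=> //.
have kN : (k == 2) || (0 < #|avoiders tau|)%N.
  by case: eqP => //= /eqP k_neq2; apply: avoiders_gt0; rewrite ltn_neqAle eq_sym k_neq2.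
pose d := (k.+1).*2.
have cvg_r := cvg_recurrence_root k2 kN (size_strings0 (letters tau))
  (size_strings_letters tau k2) r1 r_root d.
have cvg_re : ((size (strings (letters tau) (n - d)))%:R `^ n%:R^-1)%:E @[n --> \oo] --> r%:E.
  by apply: cvg_EFin cvg_r; near=> n.
apply: cvg_trans cvg_re; apply: near_eq_cvg; near=> n.
rewrite /count_root (count_length_U (L := letters tau) (k := k)) ?size_word //.
- exact: A_letters.
- exact: letters_uniq.
- exact: letters_blocks.
- exact: letters_size.
- exact: word_perm.
- by rewrite -size_eq0 size_word.
- by near: n; exists (d + k).+1.
Unshelve. all: by end_near. Qed.

(** The terms M^k / k! of the exponential series tend to 0. *)
Lemma near_geometric_leq_factorial (M : nat) : \forall k \near \oo, (M ^ k <= k`!)%N.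
Proof.
have := cvg_series_cvg_0 (is_cvg_series_exp_coeff (M%:R : R)).
move=> /cvgrPdist_le /(_ 1 ltr01); apply: filterS => k.
rewrite sub0r normrN /exp_coeff /= ger0_norm ?divr_ge0 ?exprn_ge0 //.
by rewrite ler_pdivrMr ?ltr0n ?fact_gt0 // mul1r -natrX ler_nat.
Qed.

(** The k^2 permutations lost in the estimate k! - k^2 are absorbed by
M^k + k^2 <= M^k + 4^k <= (M + 4)^k <= k!. *)
Lemma near_geometric_leq_avoiders (tau : forall k, 'S_k.-1) (M : nat) :
  \forall k \near \oo, (M ^ k <= #|avoiders (tau k)|)%N.
Proof.
near=> k.
have k0 : (0 < k)%N by near: k; exists 1%N.
have fact_k : ((M + 4) ^ k <= k`!)%N by near: k; apply: near_geometric_leq_factorial.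
have le_k := factorial_leq_avoiders (tau k) k0.
have k2 : (k ^ 2 <= 4 ^ k)%N.
  by rewrite -[4%N]/(2 ^ 2)%N -expnM mulnC expnM leq_exp2r // ltnW // ltn_expl.
have : (M ^ k + 4 ^ k <= (M + 4) ^ k)%N.
  case: (k) k0 => // j _; elim: j => [|j IHj]; first by rewrite !expn1.
  rewrite expnS [(4 ^ _)%N]expnS [leqRHS]expnS.
  apply: leq_trans (_ : (M + 4) * (M ^ j.+1 + 4 ^ j.+1) <= _)%N; last by rewrite leq_mul2l IHj orbT.
  by rewrite mulnDl !mulnDr; lia.
lia.
Unshelve. all: by end_near. Qed.

Lemma gr_U_cvgy (tau : forall k, 'S_k.-1) (alpha : forall k, 'S_k.+1) :
  gr R (U (A_ (tau k)) (word (alpha k))) @[k --> \oo] --> +oo%E.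
Proof.
apply/cvgeyPge => B; near=> k.
have k2 : (2 <= k)%N by near: k; exists 2%N.
have [r [r1 r_root cvg_r]] := cvg_count_root_U (tau k) (alpha k) k2.
rewrite /gr (cvg_limn_einf_sup cvg_r).2 lee_fin; pose M := (Num.truncn B).+1.
apply: le_trans (ltW (truncnS_gt B)) _; rewrite -/M.
rewrite -(ler_pXn2r (ltnW k2)) ?nnegrE ?ler0n ?(le_trans ler01 r1) //.
rewrite r_root -natrX; apply: le_trans (_ : #|avoiders (tau k)|%:R <= _).
  by rewrite ler_nat; near: k; apply: near_geometric_leq_avoiders.
by rewrite lerDr (le_trans ler01).
Unshelve. all: by end_near. Qed.

End GrowthRate.

Local Open Scope classical_set_scope.

Theorem proposition2p2 (R : realType) :
  (forall (k : nat) (tau : 'S_k.-1) (alpha : 'S_k.+1), (2 <= k)%N ->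
     proper_growth_rate R (U (@A_ k tau) (word alpha))) /\
  (forall (tau : forall k : nat, 'S_k.-1) (alpha : forall k : nat, 'S_k.+1),
     gr R (U (@A_ k (tau k)) (word (alpha k))) @[k --> \oo] --> +oo%E).
Proof.
split=> [k tau alpha k2 | tau alpha].
  have [r [_ _ /cvg_limn_einf_sup [einf_r esup_r]]] := cvg_count_root_U R tau alpha k2.
  by rewrite /proper_growth_rate einf_r esup_r.
exact: gr_U_cvgy.
Qed.
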